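(* Let $\mathcal{G}$ be a groupoid such that $\mathcal{G}_0$ is finite, $A$ a $\mathcal{G}$-graded algebra, $X$ a finite split $\mathcal{G}$-set via $\alpha=(X_g,\alpha_g)_{g\in\mathcal{G}}$, and $x\in X$. Let $A^{\mathcal{G}_x}$, the bimodules $V^x$ and ${}^xV$, and the maps $(\,,)$ and $[\,,]$ be as defined in the context. Then: (i) $[A\#_\alpha^{\mathcal{G}}X,\ V^x,\ {}^xV,\ A^{\mathcal{G}_x},\ [\,,],\ (\,,)]$ is a Morita context. (ii) If the Morita context is strict and $X_e\neq\emptyset$ for all $e\in\mathcal{G}_0$, then $$\sum_{g\in\mathcal{G},\ \alpha_g(y)=x}A_{g^{-1}}A_g=\sum_{g\in\mathcal{G}}A_{d(g)}\quad\text{for all }y\in X.$$ (iii) If $$\sum_{g\in\mathcal{G},\ \alpha_g(y)=x}A_{g^{-1}}A_g=\sum_{g\in\mathcal{G}}A_{d(g)}\quad\text{for all }y\in X,$$ then the Morita context is strict.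
   Context: All algebras are associative and unital over a fixed field $\Bbbk$. A groupoid $\mathcal{G}$ is a small category in which every morphism is invertible; it is identified with its set of morphisms. $d(g), r(g)$ are the domain and range of $g$, $\mathcal{G}_0$ is the set of objects, identified with the identity morphisms, so $\mathcal{G}_0\subseteq\mathcal{G}$. The product $gh$ is defined iff $d(g)=r(h)$. For $e\in\mathcal{G}_0$: $\mathcal{G}_e=\{g: d(g)=r(g)=e\}$, $D_e=\{g:d(g)=e\}$, $R_e=\{g:r(g)=e\}$. An action of $\mathcal{G}$ on a set $X$ is $\alpha=(X_g,\alpha_g)_{g\in\mathcal{G}}$ with $X_g=X_{r(g)}\subseteq X$ and $\alpha_g:X_{g^{-1}}\to X_g$ bijections such that $\alpha_e=\mathrm{id}_{X_e}$ for $e\in\mathcal{G}_0$, and $\alpha_g(\alpha_h(x))=\alpha_{gh}(x)$ whenever $d(g)=r(h)$ and $x\in X_{h^{-1}}$. Then $X$ is a $\mathcal{G}$-set; it is split if $X=\coprod_{e\in\mathcal{G}_0}X_e$ (disjoint union). In sums indexed by $g$ with $\alpha_g(y)=x$, it is understood that $y\in X_{g^{-1}}=X_{d(g)}$. An algebra $A$ is $\mathcal{G}$-graded if $A=\oplus_{g\in\mathcal{G}}A_g$ for subspaces $A_g$ with $A_gA_h\subseteq A_{gh}$ if $d(g)=r(h)$ and $A_gA_h=0$ otherwise. $A_gA_h$ denotes the linear span of the products; for $a\in A$, $a_g$ or $(a)_g$ is its component in $A_g$. When $\mathcal{G}_0$ is finite, each $A_e$ ($e\in\mathcal{G}_0$)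 is unital with identity $1_e$ and $1_A=\sum_e1_e$. The smash product is $A\#_\alpha^{\mathcal{G}}X=\oplus_{g\in\mathcal{G}}\oplus_{x\in X_{d(g)}}A_g\delta_x$ ($\delta_x$ symbols) with $(a_g\delta_x)(b_h\delta_y)=a_gb_h\delta_y$ if $d(g)=r(h)$ and $\alpha_h(y)=x$, and $0$ otherwise; its identity is $\sum_{e\in\mathcal{G}_0}\sum_{x\in X_e}1_e\delta_x$. Fix $x\in X_e$. The $x$-stabilizer is $\mathcal{G}_x=\{g\in\mathcal{G}_e:\alpha_g(x)=x\}$ and $A^{\mathcal{G}_x}=\oplus_{g\in\mathcal{G}_x}A_g$, an algebra with identity $1_e$. For $z\in X_f$, $z'\in X_{f'}$, put $V_{z,z'}=\oplus_{h\in D_f\cap R_{f'},\,\alpha_h(z)=z'}A_h$. Set ${}^xV=\oplus_{y\in X}V_{x,y}$ and $V^x=\oplus_{y\in X}V_{y,x}$; for $w\in{}^xV$ write $w=\sum_yw_y$ with $w_y\in V_{x,y}$, and for $v\in V^x$ write $v=\sum_yv_y$ with $v_y\in V_{y,x}$. ${}^xV$ is an $(A\#_\alpha^{\mathcal{G}}X,A^{\mathcal{G}_x})$-bimodule with $(a_g\delta_y)\cdot w=a_gw_y$ and right multiplication by $A^{\mathcal{G}_x}$; $V^x$ is an $(A^{\mathcal{G}_x},A\#_\alpha^{\mathcal{G}}X)$-bimodule with $v\cdot(a_g\delta_y)=(va_g)_y$ and left multiplication by $A^{\mathcal{G}_x}$. Define $$(\,,):V^x\otimes_{A\#_\alpha^{\mathcal{G}}X}{}^xV\to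 A^{\mathcal{G}_x},\quad (v,w)=\sum_{g\in\mathcal{G}_x}(vw)_g,$$ $$[\,,]:{}^xV\otimes_{A^{\mathcal{G}_x}}V^x\to A\#_\alpha^{\mathcal{G}}X,\quad [w,v]=\sum_{z\in X}(wv_z)\delta_z .$$ Being a Morita context means that $(\,,)$ is a morphism of $A^{\mathcal{G}_x}$-bimodules, $[\,,]$ is a morphism of $A\#_\alpha^{\mathcal{G}}X$-bimodules, and $v\cdot[w,v']=(v,w)v'$, $[w,v]\cdot w'=w(v,w')$ for all $v,v'\in V^x$, $w,w'\in{}^xV$. It is strict if both $(\,,)$ and $[\,,]$ are surjective.
   Formalization: In (ii) and (iii) the right-hand sum of A_{d(g)} is taken only over g with y in X_{d(g)}, so it equals A_f for y in X_f; over all g, (ii) fails for the pair groupoid on {1,2}, A = M_2(k), X = {1,2}, x = 1, y = 2. *)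

(* Defs.v *)
From HB Require Import structures.
From mathcomp Require Import all_boot all_order all_algebra finmap.

Set Implicit Arguments.
Unset Strict Implicit.
Unset Printing Implicit Defensive.

Import GRing.Theory.
Local Open Scope ring_scope.

(* The library's algType requires 1 != 0, but the algebra A^(G_x) below is zero *)
(* as soon as A_e = 0; kalgebra k is the type of associative unital k-algebras *)
(* with the zero algebra allowed.                                              *)
Record kalgebra (k : pzRingType) := KAlgebra {
  kalg_mod : lmodType k;
  kalg_mul : kalg_mod -> kalg_mod -> kalg_mod;
  kalg_one : kalg_mod;
  kalg_mulA : associative kalg_mul;
  kalg_mul1l : left_id kalg_one kalg_mul;
  kalg_mul1r : right_id kalg_one kalg_mul;
  kalg_linl : forall b, linear (kalg_mul^~ b);
  kalg_linr : forall a, linear (kalg_mul a) }.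

Definition kalg_sort (k : pzRingType) (A : kalgebra k) : Type := kalg_mod A.
Coercion kalg_sort : kalgebra >-> Sortclass.

Section KAlgebraRing.
Variables (k : pzRingType) (A : kalgebra k).

HB.instance Definition _ := GRing.Lmodule.copy (kalg_sort A) (kalg_mod A).

Lemma kalg_mulDl : left_distributive (@kalg_mul k A) +%R.
Proof. by move=> a b c; have := kalg_linl c 1 a b; rewrite !scale1r. Qed.

Lemma kalg_mulDr : right_distributive (@kalg_mul k A) +%R.
Proof. by move=> a b c; have := kalg_linr a 1 b c; rewrite !scale1r. Qed.

HB.instance Definition _ := GRing.Zmodule_isPzRing.Build (kalg_sort A)
  (@kalg_mulA k A) (@kalg_mul1l k A) (@kalg_mul1r k A) kalg_mulDl kalg_mulDr.

Lemma kalg_scaleAl c (a b : A) : c *: (a * b) = (c *: a) * b.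
Proof.
have : (c *: a + 0) * b = c *: (a * b) + 0 * b := kalg_linl b c a 0.
by rewrite addr0 mul0r addr0.
Qed.

Lemma kalg_scaleAr c (a b : A) : c *: (a * b) = a * (c *: b).
Proof.
have : a * (c *: b + 0) = c *: (a * b) + a * 0 := kalg_linr a c b 0.
by rewrite addr0 mulr0 addr0.
Qed.

End KAlgebraRing.

Section OfAlgType.
Variables (k : pzRingType) (A : algType k).

Lemma alg_mul_linl (b : A) : linear ( *%R^~ b).
Proof. by move=> c a a'; rewrite mulrDl scalerAl. Qed.

Lemma alg_mul_linr (a : A) : linear ( *%R a).
Proof. by move=> c b b'; rewrite mulrDr scalerAr. Qed.

Definition kalgebra_of : kalgebra k :=
  KAlgebra (@mulrA A) (@mul1r A) (@mulr1 A) alg_mul_linl alg_mul_linr.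

End OfAlgType.

Section Spans.
Variables (k : fieldType) (A : kalgebra k).

Definition lspan (S : A -> Prop) (a : A) : Prop :=
  exists2 s : seq (k * A),
    (forall p, p \in s -> S p.2) & a = \sum_(p <- s) p.1 *: p.2.

Definition prodsp (U V : A -> Prop) : A -> Prop :=
  lspan (fun c => exists a b, [/\ U a, V b & c = a * b]).

Definition sumsp (I : Type) (P : I -> Prop) (U : I -> A -> Prop) : A -> Prop :=
  lspan (fun a => exists2 i, P i & U i a).

End Spans.

(* Bimodules over k-algebras are k-central: both actions are k-bilinear for    *)
(* one and the same k-module structure on M.                                   *)
Record bimodule (k : fieldType) (R S : kalgebra k) (M : lmodType k)
    (l : R -> M -> M) (r : M -> S -> M) : Prop := Bimodule {
  bim_linl : forall m, linear (l^~ m);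
  bim_linlr : forall a, linear (l a);
  bim_linr : forall m, linear (r m);
  bim_linrl : forall b, linear (r^~ b);
  bim_l1 : forall m, l 1 m = m;
  bim_lM : forall a b m, l (a * b) m = l a (l b m);
  bim_r1 : forall m, r m 1 = m;
  bim_rM : forall m a b, r m (a * b) = r (r m a) b;
  bim_lr : forall a m b, l a (r m b) = r (l a m) b }.

(* By the universal property of the tensor product, a morphism of              *)
(* (S,S)-bimodules M (x)_R N -> S, with M an (S,R)- and N an (R,S)-bimodule,   *)
(* is a k-bilinear R-balanced map f : M -> N -> S that commutes with both      *)
(* actions of S.                                                               *)
Record tensor_bimodule_morphism (k : fieldType) (R S : kalgebra k)
    (M N : lmodType k) (lM : S -> M -> M) (rM : M -> R -> M)
    (lN : R -> N -> N) (rN : N -> S -> N) (f : M -> N -> S) : Prop := {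
  tbm_linl : forall n, linear (f^~ n);
  tbm_linr : forall m, linear (f m);
  tbm_balanced : forall m a n, f (rM m a) n = f m (lN a n);
  tbm_left : forall s m n, f (lM s m) n = s * f m n;
  tbm_right : forall m n s, f m (rN n s) = f m n * s }.

(* Surjectivity of the map out of the tensor product induced by f: the         *)
(* elements of the tensor product are the finite sums of pure tensors.         *)
Definition tensor_surjective (k : fieldType) (M N T : lmodType k)
    (f : M -> N -> T) : Prop :=
  forall t, exists s : seq (M * N), t = \sum_(p <- s) f p.1 p.2.

Section Morita.
Variables (k : fieldType) (R : kalgebra k) (V W : lmodType k) (S : kalgebra k).
Variables (lV : S -> V -> V) (rV : V -> R -> V).
Variables (lW : R -> W -> W) (rW : W -> S -> W).
Variables (br : W -> V -> R) (pr : V -> W -> S).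

Record morita_context : Prop := MoritaContext {
  mor_bimV : bimodule lV rV;
  mor_bimW : bimodule lW rW;
  mor_pr : tensor_bimodule_morphism lV rV lW rW pr;
  mor_br : tensor_bimodule_morphism lW rW lV rV br;
  mor_assocV : forall v w v', rV v (br w v') = lV (pr v w) v';
  mor_assocW : forall w v w', lW (br w v) w' = rW w (pr v w') }.

Definition strict : Prop := tensor_surjective pr /\ tensor_surjective br.

End Morita.

(* gmul is total; gmul g h is only meaningful when gdom g = grng h. An object  *)
(* e is seen in G as the identity gid e.                                       *)
Record groupoid (G0 G : Type) := Groupoid {
  gdom : G -> G0;
  grng : G -> G0;
  gid : G0 -> G;
  gmul : G -> G -> G;
  ginv : G -> G;
  gdom_id : forall e, gdom (gid e) = e;
  grng_id : forall e, grng (gid e) = e;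
  gdomM : forall g h, gdom g = grng h -> gdom (gmul g h) = gdom h;
  grngM : forall g h, gdom g = grng h -> grng (gmul g h) = grng g;
  gmulA : forall g h l, gdom g = grng h -> gdom h = grng l ->
    gmul g (gmul h l) = gmul (gmul g h) l;
  gmul1 : forall g, gmul g (gid (gdom g)) = g;
  g1mul : forall g, gmul (gid (grng g)) g = g;
  gdomV : forall g, gdom (ginv g) = grng g;
  grngV : forall g, grng (ginv g) = gdom g;
  gmulV : forall g, gmul g (ginv g) = gid (grng g);
  gVmul : forall g, gmul (ginv g) g = gid (gdom g) }.

(* gact_on e is X_e; since X_g = X_(r(g)), X_g is gact_on (grng g) and         *)
(* X_(g^-1) is gact_on (gdom g). The map gact g is only meaningful there.      *)
Record gset (G0 G : Type) (Gd : groupoid G0 G) (X : Type) := GSet {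
  gact_on : G0 -> {pred X};
  gact : G -> X -> X;
  gact_to : forall g x, x \in gact_on (gdom Gd g) ->
    gact g x \in gact_on (grng Gd g);
  gact_inj : forall g, {in gact_on (gdom Gd g) &, injective (gact g)};
  gact_surj : forall g y, y \in gact_on (grng Gd g) ->
    exists2 x, x \in gact_on (gdom Gd g) & gact g x = y;
  gact1 : forall e x, x \in gact_on e -> gact (gid Gd e) x = x;
  gactM : forall g h x, gdom Gd g = grng Gd h -> x \in gact_on (gdom Gd h) ->
    gact g (gact h x) = gact (gmul Gd g h) x }.

Definition gset_split (G0 G X : Type) (Gd : groupoid G0 G) (al : gset Gd X) :=
  (forall x, exists e, x \in gact_on al e) /\
  (forall x e f, x \in gact_on al e -> x \in gact_on al f -> e = f).

Definition decomposes (G : choiceType) (k : fieldType) (A : kalgebra k)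
    (B : G -> {pred A}) (a : A) (c : {fsfun G -> A with 0}) : bool :=
  all (fun g => c g \in B g) (finsupp c) && (a == \sum_(g <- finsupp c) c g).

Record grading (G0 : Type) (G : choiceType) (Gd : groupoid G0 G)
    (k : fieldType) (A : kalgebra k) := Grading {
  gpart : G -> {pred A};
  gpart_submod : forall g, submod_closed (gpart g);
  gpartM : forall g h a b, gdom Gd g = grng Gd h ->
    a \in gpart g -> b \in gpart h -> a * b \in gpart (gmul Gd g h);
  gpartM0 : forall g h a b, gdom Gd g <> grng Gd h ->
    a \in gpart g -> b \in gpart h -> a * b = 0;
  gpart_dec : forall a, exists c, decomposes gpart a c;
  gpart_dec_uniq : forall a c c',
    decomposes gpart a c -> decomposes gpart a c' -> c = c' }.

Section Components.
Variables (G0 : finType) (G : choiceType) (Gd : groupoid G0 G).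
Variables (k : fieldType) (A : kalgebra k) (gr : grading Gd A).

Local Notation d := (gdom Gd).
Local Notation r := (grng Gd).

(* gcomp a g is the component a_g of a in A_g.                                 *)
Definition gcomp (a : A) : {fsfun G -> A with 0} := xchoose (gpart_dec gr a).

(* hsum P is the subspace (+)_(g | P g) A_g of A, and hproj P the projection   *)
(* of A onto it that kills A_g when ~~ P g.                                    *)
Definition hsum (P : pred G) : {pred A} :=
  [pred a | all P (finsupp (gcomp a))].

Definition hproj (P : pred G) (a : A) : A :=
  \sum_(g <- finsupp (gcomp a) | P g) gcomp a g.

Definition one_at (e : G0) : A := gcomp 1 (gid Gd e).

Lemma gpart0 g : 0 \in gpart gr g.
Proof. by case: (gpart_submod gr g). Qed.

Lemma gpartL g c a b : a \in gpart gr g -> b \in gpart gr g -> c *: a + b \in gpart gr g.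
Proof. by case: (gpart_submod gr g) => _ h; apply: h. Qed.

Lemma gpartD g a b : a \in gpart gr g -> b \in gpart gr g -> a + b \in gpart gr g.
Proof. by move=> /(@gpartL g 1 a b); rewrite scale1r. Qed.

Lemma decP (B : G -> {pred A}) a (c : {fsfun G -> A with 0}) : (forall g, 0 \in B g) ->
  reflect ((forall g, c g \in B g) /\ a = \sum_(g <- finsupp c) c g)
          (decomposes B a c).
Proof.
move=> B0; apply: (iffP andP) => [[/allP h /eqP ->]|[h ->]].
  split=> // g; case: (boolP (g \in finsupp c)) => [/h //|].
  by rewrite memNfinsupp => /eqP ->.
by split=> //; apply/allP => g _; apply: h.
Qed.

Lemma gcomp_dec a : decomposes (gpart gr) a (gcomp a).
Proof. exact: xchooseP. Qed.

Lemma gcomp_gpart a g : gcomp a g \in gpart gr g.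
Proof. by case: (decP a (gcomp a) gpart0) (gcomp_dec a) => // -[]. Qed.

Lemma gcomp_sum a : a = \sum_(g <- finsupp (gcomp a)) gcomp a g.
Proof. by case: (decP a (gcomp a) gpart0) (gcomp_dec a) => // -[]. Qed.

Lemma sum_finsupp (c : {fsfun G -> A with 0}) (F : {fset G}) :
  {subset finsupp c <= F} ->
  \sum_(g <- finsupp c) c g = \sum_(g <- F) c g.
Proof.
move=> sF; rewrite (@big_fset_incl _ _ _ _ _ F) //.
  by apply/fsubsetP.
by move=> g _; rewrite memNfinsupp => /eqP.
Qed.

Lemma gcomp_uniq a (F : {fset G}) (f : G -> A) :
  (forall g, f g \in gpart gr g) -> (forall g, g \notin F -> f g = 0) ->
  a = \sum_(g <- F) f g -> forall g, gcomp a g = f g.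
Proof.
move=> fh f0 ->.
pose c : {fsfun G -> A with 0} := [fsfun g in F => f g | 0].
have cE g : c g = f g.
  by rewrite fsfunE; case: ifPn => // /f0.
have cdec : decomposes (gpart gr) (\sum_(g <- F) f g) c.
  apply/decP; first exact: gpart0.
  split=> [g|]; first by rewrite cE.
  rewrite (@sum_finsupp _ F); first by apply: eq_bigr => g _; rewrite cE.
  by move=> g; rewrite mem_finsupp cE; apply: contraR => /f0 ->.
by move=> g; rewrite (gpart_dec_uniq (gcomp_dec _) cdec).
Qed.

Lemma gcompL c a b g : gcomp (c *: a + b) g = c *: gcomp a g + gcomp b g.
Proof.
apply: (@gcomp_uniq _ (finsupp (gcomp a) `|` finsupp (gcomp b))%fset
  (fun g => c *: gcomp a g + gcomp b g)) => [h|h|].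
- by apply: gpartL; apply: gcomp_gpart.
- rewrite in_fsetU negb_or !memNfinsupp => /andP[/eqP -> /eqP ->].
  by rewrite scaler0 addr0.
rewrite big_split /= -scaler_sumr {1}(gcomp_sum a) {1}(gcomp_sum b).
rewrite (@sum_finsupp (gcomp a) (finsupp (gcomp a) `|` finsupp (gcomp b))%fset).
  rewrite (@sum_finsupp (gcomp b) (finsupp (gcomp a) `|` finsupp (gcomp b))%fset) //.
  by move=> h; rewrite in_fsetU => ->; rewrite orbT.
by move=> h; rewrite in_fsetU => ->.
Qed.

Lemma gcomp0 g : gcomp 0 g = 0.
Proof. by have /eqP := gcompL 1 0 0 g; rewrite !scale1r addr0 eq_sym -subr_eq0 addrK => /eqP. Qed.

Lemma gcomp_id g a h : a \in gpart gr g -> gcomp a h = if h == g then a else 0.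
Proof.
move=> ag; apply: (@gcomp_uniq _ [fset g]%fset
  (fun h => if h == g then a else 0)) => [l|l|].
- by case: eqP => [->|_] //; apply: gpart0.
- by rewrite inE => /negPf ->.
by rewrite big_seq_fset1 eqxx.
Qed.

Lemma hsumP (P : pred G) a :
  reflect (forall g, ~~ P g -> gcomp a g = 0) (a \in hsum P).
Proof.
apply: (iffP allP) => h g.
  move=> nP; apply/eqP; rewrite -memNfinsupp; apply: contra nP; exact: h.
by rewrite mem_finsupp; apply: contraR => /h ->.
Qed.

Lemma hsum_submod P : submod_closed (hsum P).
Proof.
split=> [|c a b /hsumP ha /hsumP hb]; apply/hsumP => g; first by rewrite gcomp0.
by move=> nP; rewrite gcompL ha // hb // scaler0 addr0.
Qed.

Lemma hsum0 P : 0 \in hsum P. Proof. by case: (hsum_submod P). Qed.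

Lemma hsumD P a b : a \in hsum P -> b \in hsum P -> a + b \in hsum P.
Proof.
by case: (hsum_submod P) => _ h ha hb; rewrite -[a]scale1r; apply: h.
Qed.

Lemma hsum_sum P (I : Type) (s : seq I) (Q : pred I) (F : I -> A) :
  (forall i, Q i -> F i \in hsum P) -> \sum_(i <- s | Q i) F i \in hsum P.
Proof.
move=> h; elim/big_ind: _ => //; [exact: hsum0 | exact: hsumD].
Qed.

Lemma gpart_hsum (P : pred G) g a : P g -> a \in gpart gr g -> a \in hsum P.
Proof.
move=> Pg ag; apply/hsumP => h nP; rewrite (gcomp_id _ ag).
by case: eqP nP => // ->; rewrite Pg.
Qed.

Lemma hsum_ind (P : pred G) (T : A -> Prop) :
  T 0 -> (forall a b, T a -> T b -> T (a + b)) ->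
  (forall g a, P g -> a \in gpart gr g -> T a) ->
  forall a, a \in hsum P -> T a.
Proof.
move=> T0 TD Th a /allP aP; rewrite (gcomp_sum a) big_seq.
apply: big_ind => // g /aP Pg; apply: Th Pg _; exact: gcomp_gpart.
Qed.

Lemma hsumT a : a \in hsum predT. Proof. by apply/hsumP. Qed.

Lemma gpart_ind (T : A -> Prop) :
  T 0 -> (forall a b, T a -> T b -> T (a + b)) ->
  (forall g a, a \in gpart gr g -> T a) -> forall a, T a.
Proof.
move=> T0 TD Th a; apply: (@hsum_ind predT) (hsumT a) => // g b _; exact: Th.
Qed.

Lemma hsumM (P Q S : pred G) a b :
  (forall g h, P g -> Q h -> d g = r h -> S (gmul Gd g h)) ->
  a \in hsum P -> b \in hsum Q -> a * b \in hsum S.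
Proof.
move=> PQS aP bQ; move: a aP; apply: hsum_ind.
- by rewrite mul0r hsum0.
- by move=> a a' ha ha'; rewrite mulrDl hsumD.
move=> g a Pg ag; move: b bQ; apply: hsum_ind.
- by rewrite mulr0 hsum0.
- by move=> b b' hb hb'; rewrite mulrDr hsumD.
move=> h b Qh bh; case: (d g =P r h) => dr.
  by apply: gpart_hsum (gpartM dr ag bh); apply: PQS.
by rewrite (gpartM0 dr ag bh) hsum0.
Qed.

Lemma hprojE P a (F : {fset G}) : {subset finsupp (gcomp a) <= F} ->
  hproj P a = \sum_(g <- F | P g) gcomp a g.
Proof.
move=> sF; rewrite /hproj big_mkcond [RHS]big_mkcond /=.
rewrite (@big_fset_incl _ _ _ _ _ F) //; first by apply/fsubsetP.
by move=> g _; rewrite memNfinsupp => /eqP ->; case: ifP.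
Qed.

Lemma hprojL P : linear (hproj P).
Proof.
move=> c a b.
set F := (finsupp (gcomp a) `|` finsupp (gcomp b))%fset.
rewrite (@hprojE P a F); last by move=> g; rewrite in_fsetU => ->.
rewrite (@hprojE P b F); last by move=> g; rewrite in_fsetU => ->; rewrite orbT.
rewrite (@hprojE P _ F).
  rewrite scaler_sumr -big_split /=; apply: eq_bigr => g _; exact: gcompL.
move=> g; rewrite mem_finsupp gcompL; apply: contraR.
rewrite in_fsetU negb_or !memNfinsupp => /andP[/eqP -> /eqP ->].
by rewrite scaler0 addr0.
Qed.

Lemma hprojD P a b : hproj P (a + b) = hproj P a + hproj P b.
Proof. by rewrite -{1}[a]scale1r hprojL scale1r. Qed.

Lemma hproj0 P : hproj P 0 = 0.
Proof. by rewrite /hproj big1 // => g _; rewrite gcomp0. Qed.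

Lemma hproj_sum P (I : Type) (s : seq I) (Q : pred I) (F : I -> A) :
  hproj P (\sum_(i <- s | Q i) F i) = \sum_(i <- s | Q i) hproj P (F i).
Proof. by rewrite (big_morph _ (hprojD P) (hproj0 P)). Qed.

Lemma hproj_gpart (P : pred G) g a : a \in gpart gr g ->
  hproj P a = if P g then a else 0.
Proof.
move=> ag; rewrite (@hprojE _ _ [fset g]%fset).
  rewrite big_mkcond big_seq_fset1; case: ifP => // _.
  by rewrite (gcomp_id _ ag) eqxx.
by move=> h; rewrite mem_finsupp (gcomp_id _ ag) inE; case: (h == g); rewrite ?eqxx.
Qed.

Lemma hproj_hsum P a : hproj P a \in hsum P.
Proof. by apply: hsum_sum => g Pg; apply: gpart_hsum Pg _; apply: gcomp_gpart. Qed.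

Lemma one_at_gpart e : one_at e \in gpart gr (gid Gd e).
Proof. exact: gcomp_gpart. Qed.

Lemma gcompD a b g : gcomp (a + b) g = gcomp a g + gcomp b g.
Proof. by rewrite -{1}[a]scale1r gcompL scale1r. Qed.

Lemma one_atl g a : a \in gpart gr g -> one_at (r g) * a = a.
Proof.
move=> ag.
have E b : gcomp (b * a) g = gcomp b (gid Gd (r g)) * a.
  elim/gpart_ind: b => [|b c hb hc|h b bh]; first by rewrite mul0r !gcomp0 mul0r.
    by rewrite mulrDl !gcompD hb hc mulrDl.
  rewrite (gcomp_id (gid Gd (r g)) bh); case: (d h =P r g) => dh; last first.
    rewrite (gpartM0 dh bh ag) gcomp0; case: eqP => [eh|_]; last by rewrite mul0r.
    by case: dh; rewrite -eh gdom_id.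
  rewrite (gcomp_id _ (gpartM dh bh ag)); case: eqP => eg.
    case: eqP => // /eqP /negP []; apply/eqP.
    have := congr1 (fun l => gmul Gd l (ginv Gd g)) eg.
    by rewrite /= gmulV -gmulA ?grngV // gmulV -dh gmul1 => ->.
  case: eqP => [eh|_]; last by rewrite mul0r.
  by case: eg; rewrite -eh g1mul.
by rewrite -E mul1r (gcomp_id _ ag) eqxx.
Qed.

Lemma one_atr g a : a \in gpart gr g -> a * one_at (d g) = a.
Proof.
move=> ag.
have E b : gcomp (a * b) g = a * gcomp b (gid Gd (d g)).
  elim/gpart_ind: b => [|b c hb hc|h b bh]; first by rewrite mulr0 !gcomp0 mulr0.
    by rewrite mulrDr !gcompD hb hc mulrDr.
  rewrite (gcomp_id (gid Gd (d g)) bh); case: (d g =P r h) => dh; last first.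
    rewrite (gpartM0 dh ag bh) gcomp0; case: eqP => [eh|_]; last by rewrite mulr0.
    by case: dh; rewrite -eh grng_id.
  rewrite (gcomp_id _ (gpartM dh ag bh)); case: eqP => eg.
    case: eqP => // /eqP /negP []; apply/eqP.
    have := congr1 (gmul Gd (ginv Gd g)) eg.
    by rewrite gVmul gmulA ?gdomV // gVmul dh g1mul => ->.
  case: eqP => [eh|_]; last by rewrite mulr0.
  by case: eg; rewrite -eh gmul1.
by rewrite -E mulr1 (gcomp_id _ ag) eqxx.
Qed.

Lemma one_atl0 g e a : a \in gpart gr g -> e != r g -> one_at e * a = 0.
Proof.
move=> ag ne; apply: (gpartM0 _ (one_at_gpart e) ag).
by rewrite gdom_id; apply/eqP.
Qed.

Lemma one_atr0 g e a : a \in gpart gr g -> e != d g -> a * one_at e = 0.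
Proof.
move=> ag ne; apply: (gpartM0 _ ag (one_at_gpart e)).
by rewrite grng_id; apply/eqP; rewrite eq_sym.
Qed.

End Components.

Section HomogeneousSubspaces.
Variables (G0 : finType) (G : choiceType) (Gd : groupoid G0 G).
Variables (k : fieldType) (A : kalgebra k) (gr : grading Gd A) (P : pred G).

Record hsub := HSub { hsub_val :> A; hsub_valP : hsub_val \in hsum gr P }.

HB.instance Definition _ := [isSub for hsub_val].
HB.instance Definition _ := [Choice of hsub by <:].
HB.instance Definition _ :=
  GRing.SubChoice_isSubLmodule.Build k A (hsum gr P) hsub (hsum_submod gr P).

End HomogeneousSubspaces.

Section SmashProduct.
Variables (G0 : finType) (G : choiceType) (Gd : groupoid G0 G).
Variables (k : fieldType) (A : kalgebra k) (gr : grading Gd A).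
Variables (X : finType) (al : gset Gd X).

Local Notation d := (gdom Gd).
Local Notation r := (grng Gd).
Local Notation X_ := (gact_on al).
Local Notation act := (gact al).

(* Vdeg z z' is the set of degrees of V_(z,z'): for z in X_f and z' in X_f',   *)
(* the conditions on d h and r h say that h is in D_f and R_f' (X is split).   *)
Definition Vdeg (z z' : X) : pred G :=
  fun h => [&& z \in X_ (d h), z' \in X_ (r h) & act h z == z'].

Definition overdeg (y : X) : pred G := fun g => y \in X_ (d g).

Definition smash_pred : {pred {ffun X -> A}} :=
  [pred u | [forall y, (u : {ffun X -> A}) y \in hsum gr (overdeg y)]].

Fact smash_submod : submod_closed smash_pred.
Proof.
split=> [|c u v /forallP hu /forallP hv]; apply/forallP => y; rewrite !ffunE.
  exact: hsum0.
by case: (hsum_submod gr (overdeg y)) => _; apply.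
Qed.

(* The element sum_y u_y delta_y of the smash product, with u_y in the sum of  *)
(* the A_g such that y is in X_(d(g)), is encoded by the function y |-> u_y.   *)
Record smash_sort := Smash {
  smash_val :> {ffun X -> A}; smash_valP : smash_val \in smash_pred }.

HB.instance Definition _ := [isSub for smash_val].
HB.instance Definition _ := [Choice of smash_sort by <:].
HB.instance Definition _ := GRing.SubChoice_isSubLmodule.Build k
  {ffun X -> A} smash_pred smash_sort smash_submod.

Lemma smash_valE (u : smash_sort) y : u y \in hsum gr (overdeg y).
Proof. by case: u => u /= /forallP. Qed.

Lemma smashP (u v : smash_sort) : (forall y, u y = v y) -> u = v.
Proof. by move=> h; apply: val_inj; apply/ffunP. Qed.

Fact sdelta_subproof (a : A) y :
  [ffun z => if z == y then hproj gr (overdeg y) a else 0] \in smash_pred.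
Proof.
apply/forallP => z; rewrite ffunE; case: eqP => [->|_]; last exact: hsum0.
exact: hproj_hsum.
Qed.

(* a delta_y; the projection only matters when a is not of the right degree.   *)
Definition sdelta (a : A) (y : X) : smash_sort := Smash (sdelta_subproof a y).

Fact smash_mul_subproof (u v : smash_sort) :
  [ffun y => \sum_(x : X) u x * hproj gr (Vdeg y x) (v y)] \in smash_pred.
Proof.
apply/forallP => y; rewrite ffunE; apply: hsum_sum => x _.
apply: (@hsumM _ _ _ _ _ gr predT (Vdeg y x)); last exact: hproj_hsum.
  by move=> g h _ /and3P[yh _ _] e; rewrite /overdeg gdomM.
exact: hsumT.
Qed.

(* (u * v)_y is the sum of the (u_x)_g (v_y)_h with act h y = x; the terms     *)
(* with d(g) <> r(h) vanish in A. See sdeltaM for the formula on generators.   *)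
Definition smash_mul (u v : smash_sort) : smash_sort :=
  Smash (smash_mul_subproof u v).

Definition smash_one : smash_sort :=
  \sum_(e : G0) \sum_(x | x \in X_ e) sdelta (one_at gr e) x.

Lemma smashDE (u v : smash_sort) y : (u + v : smash_sort) y = u y + v y.
Proof. by rewrite /= !ffunE. Qed.

Lemma smashLE c (u v : smash_sort) y : (c *: u + v : smash_sort) y = c *: u y + v y.
Proof. by rewrite /= !ffunE. Qed.

Lemma smash_sumE (I : Type) (s : seq I) (P : pred I) (F : I -> smash_sort) y :
  (\sum_(i <- s | P i) F i : smash_sort) y = \sum_(i <- s | P i) F i y.
Proof.
elim/big_rec2: _ => [|i a u _ <-]; first by rewrite /= ffunE.
exact: smashDE.
Qed.

Lemma smash_mulE (u v : smash_sort) y :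
  smash_mul u v y = \sum_(x : X) u x * hproj gr (Vdeg y x) (v y).
Proof. by rewrite ffunE. Qed.

Lemma hproj_VdegM x y z b c :
  hproj gr (Vdeg z x) (b * hproj gr (Vdeg z y) c) =
  hproj gr (Vdeg y x) b * hproj gr (Vdeg z y) c.
Proof.
move: (hproj gr (Vdeg z y) c) (hproj_hsum gr (Vdeg z y) c).
clear c; apply: hsum_ind; first by rewrite !mulr0 hproj0.
  by move=> c c' hc hc'; rewrite !mulrDr hprojD hc hc'.
move=> h c /and3P[zh yh /eqP hzy] ch.
move: b; apply: (gpart_ind (gr := gr)) => [|b b' hb hb'|g b bg].
- by rewrite mul0r !hproj0 mul0r.
- by rewrite mulrDl !hprojD hb hb' mulrDl.
rewrite (hproj_gpart _ bg); case: (d g =P r h) => gh; last first.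
  by rewrite (gpartM0 gh bg ch) hproj0; case: ifP; rewrite ?mul0r ?(gpartM0 gh bg ch).
rewrite (hproj_gpart _ (gpartM gh bg ch)) /Vdeg gdomM // grngM // zh gh yh /=.
by rewrite -(gactM gh zh) hzy; case: ifP; rewrite ?mul0r.
Qed.

Lemma smash_oneE y :
  smash_one y = \sum_(e | y \in X_ e) one_at gr e.
Proof.
rewrite smash_sumE [RHS]big_mkcond; apply: eq_bigr => e _ /=.
rewrite smash_sumE big_mkcond (bigD1 y) //= ffunE eqxx big1 => [|z /negPf zy].
  rewrite addr0; case: ifP => // ye.
  by rewrite (hproj_gpart _ (one_at_gpart gr e)) /overdeg gdom_id ye.
by case: ifP; rewrite // ffunE eq_sym zy.
Qed.

Lemma sum_one_atl g y a : y \in X_ (r g) -> a \in gpart gr g ->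
  (\sum_(e | y \in X_ e) one_at gr e) * a = a.
Proof.
move=> yg ag; rewrite (bigD1 (r g)) //= mulrDl (one_atl ag) mulr_suml.
by rewrite big1 ?addr0 // => e /andP[_ ne]; apply: one_atl0 ag ne.
Qed.

Lemma sum_one_atr g y a : y \in X_ (d g) -> a \in gpart gr g ->
  a * (\sum_(e | y \in X_ e) one_at gr e) = a.
Proof.
move=> yg ag; rewrite (bigD1 (d g)) //= mulrDr (one_atr ag) mulr_sumr.
by rewrite big1 ?addr0 // => e /andP[_ ne]; apply: one_atr0 ag ne.
Qed.

Fact smash_mulA : associative smash_mul.
Proof.
move=> u v w; apply: smashP => z; rewrite !smash_mulE.
under eq_bigr => x _.
  rewrite hproj_sum mulr_sumr.
  under eq_bigr => y _ do rewrite hproj_VdegM mulrA.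
  over.
rewrite exchange_big /=; apply: eq_bigr => y _.
by rewrite smash_mulE mulr_suml.
Qed.

Fact smash_mul1l : left_id smash_one smash_mul.
Proof.
move=> u; apply: smashP => y; rewrite smash_mulE.
under eq_bigr => x _ do rewrite smash_oneE.
move: (u y) (smash_valE u y); apply: hsum_ind.
- by apply: big1 => x _; rewrite hproj0 mulr0.
- by move=> a b ha hb; under eq_bigr => x _ do
    rewrite hprojD mulrDr; rewrite big_split ha hb.
move=> g a; rewrite /overdeg => yg ag; have xg := gact_to yg.
rewrite (bigD1 (act g y)) //= (hproj_gpart _ ag) /Vdeg yg xg eqxx /=.
rewrite (sum_one_atl xg ag) big1 ?addr0 // => x /negPf ne.
by rewrite (hproj_gpart _ ag) eq_sym ne !andbF mulr0.
Qed.

Fact smash_mul1r : right_id smash_one smash_mul.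
Proof.
move=> u; apply: smashP => y; rewrite smash_mulE smash_oneE.
have E x : hproj gr (Vdeg y x) (\sum_(e | y \in X_ e) one_at gr e) =
    if x == y then \sum_(e | y \in X_ e) one_at gr e else 0.
  rewrite hproj_sum; case: (x =P y) => [->|ne].
    apply: eq_bigr => e ye; rewrite (hproj_gpart _ (one_at_gpart gr e)).
    by rewrite /Vdeg gdom_id grng_id ye gact1 // eqxx.
  apply: big1 => e ye; rewrite (hproj_gpart _ (one_at_gpart gr e)).
  rewrite /Vdeg gdom_id gact1 //; case: (y =P x) => [h|]; first by case: ne.
  by rewrite !andbF.
rewrite (bigD1 y) //= E eqxx [X in _ + X]big1 => [|x /negPf ne]; last first.
  by rewrite E ne mulr0.
rewrite addr0.
move: (u y) (smash_valE u y); apply: hsum_ind; first by rewrite mul0r.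
  by move=> a b ha hb; rewrite mulrDl ha hb.
by move=> g a yg ag; apply: sum_one_atr yg ag.
Qed.

Fact smash_linl v : linear (smash_mul^~ v).
Proof.
move=> c u u'; apply: smashP => y; rewrite smashLE !smash_mulE scaler_sumr.
rewrite -big_split; apply: eq_bigr => x _ /=.
by rewrite smashLE mulrDl kalg_scaleAl.
Qed.

Fact smash_linr u : linear (smash_mul u).
Proof.
move=> c v v'; apply: smashP => y; rewrite smashLE !smash_mulE scaler_sumr.
rewrite -big_split; apply: eq_bigr => x _ /=.
by rewrite smashLE hprojL mulrDr kalg_scaleAr.
Qed.

Definition smash : kalgebra k :=
  KAlgebra smash_mulA smash_mul1l smash_mul1r smash_linl smash_linr.

Lemma sdeltaE g a y : a \in gpart gr g -> y \in X_ (d g) ->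
  forall z, sdelta a y z = if z == y then a else 0.
Proof.
by move=> ag yg z; rewrite ffunE (hproj_gpart _ ag) /overdeg yg.
Qed.

Lemma sdeltaM g h a b x y : a \in gpart gr g -> b \in gpart gr h ->
  x \in X_ (d g) -> y \in X_ (d h) ->
  (sdelta a x : smash) * sdelta b y =
  if (d g == r h) && (act h y == x) then sdelta (a * b) y else 0.
Proof.
move=> ag bh xg yh; apply: smashP => z.
rewrite [LHS]smash_mulE (bigD1 x) //= big1 => [|x' /negPf ne]; last first.
  by rewrite (sdeltaE ag xg) ne mul0r.
rewrite addr0 (sdeltaE ag xg) eqxx (sdeltaE bh yh).
case: (d g =P r h) => gh /=; last first.
  rewrite ffunE; case: eqP => _; last by rewrite hproj0 mulr0.
  by rewrite (hproj_gpart _ bh); case: ifP; rewrite ?mulr0 ?(gpartM0 gh ag bh).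
case: (z =P y) => [->|zy]; last first.
  rewrite hproj0 mulr0; case: ifP => _; last by rewrite ffunE.
  by rewrite ffunE; case: eqP.
rewrite (hproj_gpart _ bh) /Vdeg yh -gh xg /=.
case: eqP => _; last by rewrite mulr0 ffunE.
by rewrite (sdeltaE (gpartM gh ag bh)) ?eqxx // gdomM.
Qed.

End SmashProduct.

Section AtPoint.
Variables (G0 : finType) (G : choiceType) (Gd : groupoid G0 G).
Variables (k : fieldType) (A : kalgebra k) (gr : grading Gd A).
Variables (X : finType) (al : gset Gd X).
Variables (e : G0) (x : X) (hx : x \in gact_on al e).

Local Notation d := (gdom Gd).
Local Notation r := (grng Gd).
Local Notation X_ := (gact_on al).
Local Notation act := (gact al).
Local Notation Vdeg := (Vdeg al).

Definition stabdeg : pred G :=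
  fun g => [&& d g == e, r g == e & act g x == x].

Let stabM g h : stabdeg g -> stabdeg h -> d g = r h -> stabdeg (gmul Gd g h).
Proof.
move=> /and3P[_ /eqP re /eqP gx] /and3P[/eqP de _ /eqP hx'] gh.
apply/and3P; split; rewrite ?gdomM ?grngM ?re ?de //.
by rewrite -gactM ?de // hx' gx.
Qed.

Fact stab_mul_subproof (a b : hsub gr stabdeg) : (a : A) * (b : A) \in hsum gr stabdeg.
Proof. exact: hsumM stabM (hsub_valP a) (hsub_valP b). Qed.

Fact stab_one_subproof : one_at gr e \in hsum gr stabdeg.
Proof.
apply: gpart_hsum (one_at_gpart gr e).
by rewrite /stabdeg gdom_id grng_id gact1 // !eqxx.
Qed.

Definition stab_mul (a b : hsub gr stabdeg) := HSub (stab_mul_subproof a b).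
Definition stab_one := HSub stab_one_subproof.

Fact stab_mulA : associative stab_mul.
Proof. by move=> a b c; apply: val_inj; rewrite /= mulrA. Qed.

Fact stab_mul1l : left_id stab_one stab_mul.
Proof.
case=> a ha; apply: val_inj => /=; move: a ha; apply: hsum_ind.
- by rewrite mulr0.
- by move=> a b ha hb; rewrite mulrDr ha hb.
by move=> g a /and3P[_ /eqP <- _]; apply: one_atl.
Qed.

Fact stab_mul1r : right_id stab_one stab_mul.
Proof.
case=> a ha; apply: val_inj => /=; move: a ha; apply: hsum_ind.
- by rewrite mul0r.
- by move=> a b ha hb; rewrite mulrDl ha hb.
by move=> g a /and3P[/eqP <- _ _]; apply: one_atr.
Qed.

Fact stab_linl b : linear (stab_mul^~ b).
Proof. by move=> c a a'; apply: val_inj; rewrite /= mulrDl kalg_scaleAl. Qed.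

Fact stab_linr a : linear (stab_mul a).
Proof. by move=> c b b'; apply: val_inj; rewrite /= mulrDr kalg_scaleAr. Qed.

Definition stab : kalgebra k :=
  KAlgebra stab_mulA stab_mul1l stab_mul1r stab_linl stab_linr.

(* The element y such that a degree h occurs in V_(x,y), respectively in       *)
(* V_(y,x), is determined by h, so that the direct sums over y are taken in A. *)
Definition xV := hsub gr (fun h => [exists y, Vdeg x y h]).
Definition Vx := hsub gr (fun h => [exists y, Vdeg y x h]).

Definition xVcomp (w : xV) (y : X) : A := hproj gr (Vdeg x y) w.
Definition Vxcomp (v : Vx) (y : X) : A := hproj gr (Vdeg y x) v.

Fact smash_xV_subproof (u : smash gr al) (w : xV) :
  \sum_(y : X) (u : smash_sort gr al) y * xVcomp w y
    \in hsum gr (fun h => [exists y, Vdeg x y h]).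
Proof.
apply: hsum_sum => y _.
apply: hsumM (smash_valE u y) (hproj_hsum gr (Vdeg x y) w) => g h yg.
move=> /and3P[xh yh /eqP hy] gh; apply/existsP; exists (act g y).
by rewrite /Vdeg gdomM // grngM // xh gact_to // -(gactM gh xh) hy eqxx.
Qed.

Fact xV_stab_subproof (w : xV) (a : stab) :
  (w : A) * hsub_val a \in hsum gr (fun h => [exists y, Vdeg x y h]).
Proof.
apply: hsumM (hsub_valP w) (hsub_valP a) => h g /existsP[y].
move=> /and3P[xh yh /eqP hy] /and3P[/eqP de _ /eqP gx] hg.
apply/existsP; exists y.
by rewrite /Vdeg gdomM // grngM // de hx yh -gactM ?de // gx hy eqxx.
Qed.

Fact stab_Vx_subproof (a : stab) (v : Vx) :
  hsub_val a * (v : A) \in hsum gr (fun h => [exists y, Vdeg y x h]).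
Proof.
apply: hsumM (hsub_valP a) (hsub_valP v) => g h /and3P[_ /eqP re /eqP gx].
move=> /existsP[y] /and3P[yh xh /eqP hy] gh; apply/existsP; exists y.
by rewrite /Vdeg gdomM // grngM // re hx yh -(gactM gh yh) hy gx eqxx.
Qed.

Fact Vx_smash_subproof (v : Vx) (u : smash gr al) :
  \sum_(y : X) hproj gr (Vdeg y x) ((v : A) * (u : smash_sort gr al) y)
    \in hsum gr (fun h => [exists y, Vdeg y x h]).
Proof.
apply: hsum_sum => y _.
apply/hsumP => g /existsPn /(_ y) ng.
have /hsumP h := hproj_hsum gr (Vdeg y x) ((v : A) * (u : smash_sort gr al) y).
exact: h.
Qed.

Definition smash_xV (u : smash gr al) (w : xV) : xV := HSub (smash_xV_subproof u w).
Definition xV_stab (w : xV) (a : stab) : xV := HSub (xV_stab_subproof w a).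
Definition stab_Vx (a : stab) (v : Vx) : Vx := HSub (stab_Vx_subproof a v).
Definition Vx_smash (v : Vx) (u : smash gr al) : Vx := HSub (Vx_smash_subproof v u).

Lemma smash_xV_delta g a y w : a \in gpart gr g -> y \in X_ (d g) ->
  (smash_xV (sdelta gr al a y) w : A) = a * xVcomp w y.
Proof.
move=> ag yg; rewrite /= (bigD1 y) //= (sdeltaE ag yg) eqxx.
by rewrite big1 ?addr0 // => z /negPf ne; rewrite (sdeltaE ag yg) ne mul0r.
Qed.

Lemma Vx_smash_delta g a y v : a \in gpart gr g -> y \in X_ (d g) ->
  (Vx_smash v (sdelta gr al a y) : A) = hproj gr (Vdeg y x) ((v : A) * a).
Proof.
move=> ag yg; rewrite /= (bigD1 y) //= (sdeltaE ag yg) eqxx.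
rewrite big1 ?addr0 // => z /negPf ne.
by rewrite (sdeltaE ag yg) ne mulr0 hproj0.
Qed.

Definition pairing (v : Vx) (w : xV) : stab :=
  HSub (hproj_hsum gr stabdeg ((v : A) * (w : A))).

Definition bracket (w : xV) (v : Vx) : smash gr al :=
  \sum_(z : X) sdelta gr al ((w : A) * Vxcomp v z) z.

(* The sum over the g with act g y = x of the subspaces A_(g^-1) A_g.          *)
Definition transfer_sum (y : X) : A -> Prop :=
  sumsp (fun g => y \in X_ (d g) /\ act g y = x)
        (fun g => prodsp (fun a => a \in gpart gr (ginv Gd g))
                         (fun a => a \in gpart gr g)).

(* The sum of the subspaces A_(d(g)), indexed like transfer_sum by elements g   *)
(* such that y is in X_(d(g)). For y in X_f both sums are subspaces of A_f,     *)
(* whereas over all g in G this one would be the sum of all the A_f'; equality  *)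
(* with transfer_sum y would then force A_f' = 0 for every f' <> f.             *)
Definition source_sum (y : X) : A -> Prop :=
  sumsp (fun g => y \in X_ (d g)) (fun g a => a \in gpart gr (gid Gd (d g))).

End AtPoint.

Arguments stab_Vx {G0 G Gd k A} gr {X al e x} hx a v.
Arguments xV_stab {G0 G Gd k A} gr {X al e x} hx w a.
Arguments Vx_smash {G0 G Gd k A} gr {X} al x v u.
Arguments smash_xV {G0 G Gd k A} gr {X} al x u w.
Arguments pairing {G0 G Gd k A} gr {X al e x} hx v w.
Arguments bracket {G0 G Gd k A} gr {X} al x w v.

(* Main.v *)
Require Import Defs.
From mathcomp Require Import all_boot all_order all_algebra finmap.

Set Implicit Arguments.
Unset Strict Implicit.
Unset Printing Implicit Defensive.

Import GRing.Theory.
Local Open Scope ring_scope.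

(** The bookkeeping of degrees disappears once everything is read as matrices
    indexed by [X]. Say that [a] has entry [hproj gr (Vdeg al y z) a] in row [z]
    and column [y]. An element [u] of the smash product is the matrix whose column
    [y] is made of the components in V_(y,z), over all [z], of its coefficient at
    [y]; an element of [xV] is the column at [x] of such a matrix, an element of
    [Vx] the row at [x], and an element of the stabilizer algebra the single entry
    at (x,x). The last identification uses that [X] is split, so that an arrow
    fixing [x] has both ends at the object of [x].

    Under this reading each of the operations is a product of matrices: the
    product of the smash product, the four module actions, the pairing (row times
    column) and the bracket (column times row). This is the content of
    [smash_entryM], [smash_xV_comp], [Vx_smash_comp], [xV_stab_comp],
    [stab_Vx_comp], [pairing_comp] and [bracket_entry], all of which reduce to
    [hproj_VdegM]. Since an element is determined by its entries, the axioms of a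
    Morita context become instances of the associativity of matrix products.

    For strictness, take [y] over the object [f]. If the bracket is surjective,
    an element a of A_f, placed at [y], is a sum of terms w v_y; the part of w v_y
    of degree [f] only involves products of a component of degree g^-1 with one of
    degree g, where g takes [y] to [x], so that a lies in the transfer sum
    ([gcomp_gid_transfer]). Conversely each generator a b of the transfer sum, with
    a in A_(g^-1) and b in A_g, is a bracket when placed at [y], and a pairing
    when [y] is [x]. Hence if every 1_f is in the transfer sum at every point over
    [f], both images contain the identity of their algebra; being stable under
    left multiplication, they are everything ([transfer_one_strict]). *)

(** * Spans and images of bilinear maps *)

Section Spans.
Variables (k : fieldType) (A : kalgebra k).
Implicit Types (S T : A -> Prop) (a b : A).

Lemma lspan_mem S a : S a -> lspan S a.
Proof.
move=> Sa; exists [:: (1, a)]; last by rewrite big_seq1 scale1r.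
by move=> p; rewrite inE => /eqP ->.
Qed.

Lemma lspan_ind S T : T 0 -> (forall c a b, T a -> T b -> T (c *: a + b)) ->
  (forall a, S a -> T a) -> forall a, lspan S a -> T a.
Proof.
move=> T0 TL ST _ [s sS ->]; elim: s sS => [|p s IHs] sS; first by rewrite big_nil.
rewrite big_cons; apply: TL; first by apply/ST/sS; rewrite inE eqxx.
by apply: IHs => q qs; apply: sS; rewrite inE qs orbT.
Qed.

Lemma lspan0 S : lspan S 0.
Proof. by exists [::]; rewrite ?big_nil. Qed.

Lemma lspanL S c a b : lspan S a -> lspan S b -> lspan S (c *: a + b).
Proof.
move=> [s sS ->] [s' sS' ->]; exists ([seq (c * p.1, p.2) | p <- s] ++ s').
  by move=> p; rewrite mem_cat => /orP[/mapP[q /sS ? ->]|/sS'].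
rewrite big_cat big_map scaler_sumr; congr (_ + _).
by apply: eq_bigr => p _; rewrite scalerA.
Qed.

Lemma lspanD S a b : lspan S a -> lspan S b -> lspan S (a + b).
Proof. by move=> Sa Sb; rewrite -[a]scale1r; apply: lspanL. Qed.

End Spans.

Section TensorImage.
Variables (k : fieldType) (M N T : lmodType k) (f : M -> N -> T).

Definition tensor_image (t : T) := exists s : seq (M * N), t = \sum_(p <- s) f p.1 p.2.

Lemma tensor_image_pure m n : tensor_image (f m n).
Proof. by exists [:: (m, n)]; rewrite big_seq1. Qed.

Lemma tensor_image0 : tensor_image 0.
Proof. by exists [::]; rewrite big_nil. Qed.

Lemma tensor_imageL : (forall n, linear (f^~ n)) -> forall c t t',
  tensor_image t -> tensor_image t' -> tensor_image (c *: t + t').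
Proof.
move=> fL c _ _ [s ->] [s' ->]; exists ([seq (c *: p.1, p.2) | p <- s] ++ s').
rewrite big_cat big_map scaler_sumr; congr (_ + _); apply: eq_bigr => p _ /=.
have f0 : f 0 p.2 = 0.
  by have := fL p.2 (-1) 0 0; rewrite scaler0 addr0 scaleN1r addNr.
by have := fL p.2 c p.1 0; rewrite !addr0 f0 addr0.
Qed.

Lemma tensor_image_sum : (forall n, linear (f^~ n)) ->
  forall (I : Type) (s : seq I) (P : pred I) (F : I -> T),
  (forall i, P i -> tensor_image (F i)) -> tensor_image (\sum_(i <- s | P i) F i).
Proof.
move=> fL I s P F fF; elim/big_ind: _ => //; first exact: tensor_image0.
by move=> t t' ft ft'; rewrite -[t]scale1r; apply: tensor_imageL.
Qed.

End TensorImage.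

(** The image of a bimodule morphism is an ideal. *)
Lemma tensor_surjective_one (k : fieldType) (R S : kalgebra k) (M N : lmodType k)
    (lM : S -> M -> M) (rM : M -> R -> M) (lN : R -> N -> N) (rN : N -> S -> N)
    (f : M -> N -> S) :
  tensor_bimodule_morphism lM rM lN rN f -> tensor_image f 1 -> tensor_surjective f.
Proof.
move=> fM [s s1] t; exists [seq (lM t p.1, p.2) | p <- s].
rewrite -[LHS]mulr1 s1 mulr_sumr big_map; apply: eq_bigr => p _ /=.
by rewrite (tbm_left fM).
Qed.

(** * Linearity and associativity of matrix products *)

Section MatrixProducts.
Variables (k : fieldType) (A : kalgebra k).

Lemma mul_linearl c (a a' b : A) : (c *: a + a') * b = c *: (a * b) + a' * b.
Proof. by rewrite mulrDl kalg_scaleAl. Qed.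

Lemma mul_linearr c (a b b' : A) : a * (c *: b + b') = c *: (a * b) + a * b'.
Proof. by rewrite mulrDr kalg_scaleAr. Qed.

Lemma sum_linear (I : finType) c (F F' : I -> A) :
  \sum_i (c *: F i + F' i) = c *: (\sum_i F i) + \sum_i F' i.
Proof. by rewrite big_split scaler_sumr. Qed.

(** Associativity of row times matrix times column. *)
Lemma sum_mul_sumA (I : finType) (F : I -> A) (M : I -> I -> A) (H : I -> A) :
  \sum_y F y * (\sum_z M y z * H z) = \sum_z (\sum_y F y * M y z) * H z.
Proof.
under eq_bigr do rewrite mulr_sumr.
rewrite exchange_big; apply: eq_bigr => z _ /=.
by rewrite mulr_suml; apply: eq_bigr => y _; rewrite mulrA.
Qed.

End MatrixProducts.

(** * Matrix entries *)

Section Entries.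
Variables (G0 : finType) (G : choiceType) (Gd : groupoid G0 G).
Variables (k : fieldType) (A : kalgebra k) (gr : grading Gd A).

Local Notation d := (gdom Gd).
Local Notation r := (grng Gd).

Lemma hproj_id (P Q : pred G) a :
  (forall g, P g -> Q g) -> a \in hsum gr P -> hproj gr Q a = a.
Proof.
move=> PQ; move: a; apply: hsum_ind; first by rewrite hproj0.
  by move=> a b ha hb; rewrite hprojD ha hb.
by move=> g a /PQ Qg ag; rewrite (hproj_gpart _ ag) Qg.
Qed.

Lemma hproj_disjoint (P Q : pred G) a :
  (forall g, P g -> ~~ Q g) -> a \in hsum gr P -> hproj gr Q a = 0.
Proof.
move=> PQ; move: a; apply: hsum_ind; first by rewrite hproj0.
  by move=> a b ha hb; rewrite hprojD ha hb addr0.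
by move=> g a /PQ /negPf Qg ag; rewrite (hproj_gpart _ ag) Qg.
Qed.

Variables (X : finType) (al : gset Gd X).

Local Notation X_ := (gact_on al).
Local Notation act := (gact al).
Local Notation ent y z := (hproj gr (Vdeg al y z)).

(** This is what makes the decomposition of an element of [Vx] indexed by its
    sources unambiguous: arrows act injectively. *)
Lemma Vdeg_source_uniq y y' z g : Vdeg al y z g -> Vdeg al y' z g -> y = y'.
Proof.
case/and3P=> yg _ /eqP gy /and3P[y'g _ /eqP gy'].
by apply: (gact_inj yg y'g); rewrite gy gy'.
Qed.

Lemma gactV g y : y \in X_ (d g) -> act (ginv Gd g) (act g y) = y.
Proof. by move=> yg; rewrite gactM ?gdomV // gVmul gact1. Qed.

Lemma Vdeg_ginv g y z : Vdeg al y z g -> Vdeg al z y (ginv Gd g).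
Proof.
by case/and3P=> yg zg /eqP gy; rewrite /Vdeg gdomV grngV yg zg -gy gactV /=.
Qed.

Lemma entry_id y z a : ent y z (ent y z a) = ent y z a.
Proof. exact: (hproj_id _ (hproj_hsum gr _ a)). Qed.

Lemma entry_source_neq y y' z a : y != y' -> ent y' z (ent y z a) = 0.
Proof.
move=> /eqP ne; apply: (hproj_disjoint _ (hproj_hsum gr _ a)) => g gy.
by apply/negP => gy'; apply/ne/(Vdeg_source_uniq gy gy').
Qed.

Lemma entry_mul t y z a b : ent t z (ent y z a * ent t y b) = ent y z a * ent t y b.
Proof. by rewrite hproj_VdegM entry_id. Qed.

(** An arrow acting on [y] sends it to exactly one point, so the entries in
    column [y] exhaust the degrees defined at [y]. *)
Lemma hsum_ranges y (P : pred G) a :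
  (forall g, P g -> y \in X_ (d g)) -> a \in hsum gr P ->
  a = \sum_z ent y z a.
Proof.
move=> Py; move: a; apply: hsum_ind.
- by rewrite big1 // => z _; rewrite hproj0.
- by move=> a b {1}-> {1}->; rewrite -big_split; apply: eq_bigr => z _; rewrite hprojD.
move=> g a /Py yg ag; rewrite (bigD1 (act g y)) //= big1 => [|z /negPf ne].
  by rewrite addr0 (hproj_gpart _ ag) /Vdeg yg gact_to // eqxx.
by rewrite (hproj_gpart _ ag) /Vdeg eq_sym ne !andbF.
Qed.

Lemma hsum_sources z a :
  a \in hsum gr (fun h => [exists y, Vdeg al y z h]) -> a = \sum_y ent y z a.
Proof.
move: a; apply: hsum_ind.
- by rewrite big1 // => y _; rewrite hproj0.
- by move=> a b {1}-> {1}->; rewrite -big_split; apply: eq_bigr => y _; rewrite hprojD.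
move=> g a /existsP[y gy] ag; rewrite (bigD1 y) //= big1 => [|t ty].
  by rewrite addr0 (hproj_gpart _ ag) gy.
rewrite (hproj_gpart _ ag); case: ifP => // gt.
by rewrite (Vdeg_source_uniq gt gy) eqxx in ty.
Qed.

(** Row [z], column [y] of the matrix of [u]. *)
Definition smash_entry (u : smash gr al) (z y : X) : A :=
  ent y z ((u : smash_sort gr al) y).

Lemma smash_col (u : smash gr al) y :
  (u : smash_sort gr al) y = \sum_z smash_entry u z y.
Proof. exact: hsum_ranges (smash_valE u y). Qed.

Lemma smash_entryP (u v : smash gr al) :
  (forall z y, smash_entry u z y = smash_entry v z y) -> u = v.
Proof.
by move=> uv; apply: smashP => y; rewrite !smash_col; apply: eq_bigr => z _.
Qed.

Lemma smash_entryM (u v : smash gr al) z y :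
  smash_entry (u * v) z y = \sum_t smash_entry u z t * smash_entry v t y.
Proof.
rewrite /smash_entry [X in ent y z X]smash_mulE hproj_sum.
by apply: eq_bigr => t _; rewrite hproj_VdegM.
Qed.

(** The diagonal entry at [y] is the identity of the object of [y], written as
    a sum over the objects [e] with [y] in X_e; for a split [X] it has one term. *)
Lemma smash_entry1 z y :
  smash_entry 1 z y = if z == y then \sum_(e | y \in X_ e) one_at gr e else 0.
Proof.
rewrite /smash_entry [X in ent y z X]smash_oneE hproj_sum.
case: (z =P y) => [->|ne].
  apply: eq_bigr => e ye; rewrite (hproj_gpart _ (one_at_gpart gr e)).
  by rewrite /Vdeg gdom_id grng_id ye gact1 // eqxx.
apply: big1 => e ye; rewrite (hproj_gpart _ (one_at_gpart gr e)).
by rewrite /Vdeg gact1 ?gdom_id //; case: (y =P z) => [h|]; [case: ne | rewrite !andbF].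
Qed.

Lemma one_mul_entry y z a : (\sum_(e | z \in X_ e) one_at gr e) * ent y z a = ent y z a.
Proof.
move: (hproj_hsum gr (Vdeg al y z) a); move: (ent y z a); apply: hsum_ind.
- by rewrite mulr0.
- by move=> b c hb hc; rewrite mulrDr hb hc.
by move=> g b /and3P[_ zg _]; apply: sum_one_atl.
Qed.

Lemma entry_mul_one y z a : ent y z a * (\sum_(e | y \in X_ e) one_at gr e) = ent y z a.
Proof.
move: (hproj_hsum gr (Vdeg al y z) a); move: (ent y z a); apply: hsum_ind.
- by rewrite mul0r.
- by move=> b c hb hc; rewrite mulrDl hb hc.
by move=> g b /and3P[yg _ _]; apply: sum_one_atr.
Qed.

Lemma sdeltaL y c a b : sdelta gr al (c *: a + b) y = c *: sdelta gr al a y + sdelta gr al b y.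
Proof.
apply: smashP => z; rewrite smashLE !ffunE; case: eqP => _; first exact: hprojL.
by rewrite scaler0 addr0.
Qed.

Lemma sdelta0 y : sdelta gr al 0 y = 0.
Proof. by apply: smashP => z; rewrite !ffunE hproj0 if_same. Qed.

Section AtPoint.
Variables (x : X).

Local Notation xV := (xV gr al x).
Local Notation Vx := (Vx gr al x).

Lemma xV_col (w : xV) : (w : A) = \sum_y xVcomp w y.
Proof.
by apply: hsum_ranges (hsub_valP w) => g /existsP[y /and3P[]].
Qed.

Lemma Vx_row (v : Vx) : (v : A) = \sum_y Vxcomp v y.
Proof. exact: hsum_sources (hsub_valP v). Qed.

Lemma xVcompP (w w' : xV) : (forall y, xVcomp w y = xVcomp w' y) -> w = w'.
Proof.
by move=> ww'; apply: val_inj; rewrite /= !xV_col; apply: eq_bigr => y _.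
Qed.

Lemma VxcompP (v v' : Vx) : (forall y, Vxcomp v y = Vxcomp v' y) -> v = v'.
Proof.
by move=> vv'; apply: val_inj; rewrite /= !Vx_row; apply: eq_bigr => y _.
Qed.

Lemma smash_xV_comp u w z :
  xVcomp (smash_xV gr al x u w) z = \sum_y smash_entry u z y * xVcomp w y.
Proof.
rewrite /xVcomp /= hproj_sum; apply: eq_bigr => y _; exact: hproj_VdegM.
Qed.

Lemma Vx_smash_comp v u y :
  Vxcomp (Vx_smash gr al x v u) y = \sum_z Vxcomp v z * smash_entry u z y.
Proof.
rewrite /Vxcomp /= hproj_sum (bigD1 y) //= entry_id [X in _ + X]big1; last first.
  by move=> t; apply: entry_source_neq.
rewrite addr0 [in LHS]smash_col mulr_sumr hproj_sum.
apply: eq_bigr => z _; exact: hproj_VdegM.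
Qed.

(** The product w v_y is already supported on degrees defined at [y], hence the
    projection built into [sdelta] does not alter it. *)
Lemma bracket_col (w : xV) (v : Vx) y :
  (bracket gr al x w v : smash_sort gr al) y = (w : A) * Vxcomp v y.
Proof.
have wvy : (w : A) * Vxcomp v y \in hsum gr (overdeg al y).
  apply: (@hsumM _ _ _ _ _ gr predT (Vdeg al y x)); last exact: hproj_hsum.
    by move=> g h _ /and3P[yh _ _] gh; rewrite /overdeg gdomM.
  exact: hsumT.
rewrite /bracket smash_sumE (bigD1 y) //= big1 => [|t /negPf ne].
  by rewrite addr0 ffunE eqxx (hproj_id _ wvy).
by rewrite ffunE eq_sym ne.
Qed.

Lemma bracket_entry w v z y :
  smash_entry (bracket gr al x w v) z y = xVcomp w z * Vxcomp v y.
Proof. by rewrite /smash_entry bracket_col hproj_VdegM. Qed.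

Lemma xVcompL c (w w' : xV) y : xVcomp (c *: w + w') y = c *: xVcomp w y + xVcomp w' y.
Proof. exact: hprojL. Qed.

Lemma VxcompL c (v v' : Vx) y : Vxcomp (c *: v + v') y = c *: Vxcomp v y + Vxcomp v' y.
Proof. exact: hprojL. Qed.

Lemma smash_entryL c (u u' : smash gr al) z y :
  smash_entry (c *: u + u') z y = c *: smash_entry u z y + smash_entry u' z y.
Proof. by rewrite /smash_entry smashLE hprojL. Qed.

Lemma bracketL (v : Vx) : linear (bracket gr al x ^~ v).
Proof.
move=> c w w'; apply: smash_entryP => z y.
by rewrite smash_entryL !bracket_entry xVcompL mul_linearl.
Qed.

Variables (e : G0) (hx : x \in gact_on al e).
Hypothesis x_split : forall f, x \in X_ f -> f = e.

Local Notation stab := (stab gr hx).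

(** The stabilizer algebra is the diagonal entry at [x]: splitness puts both
    ends of an arrow fixing [x] at [e]. *)
Lemma stabdegE g : stabdeg al e x g = Vdeg al x x g.
Proof.
apply/and3P/and3P => [[/eqP -> /eqP -> gx]|[/x_split -> /x_split -> gx]];
  by split.
Qed.

Lemma stab_entry (a : stab) : ent x x (hsub_val a) = hsub_val a.
Proof. by apply: hproj_id (hsub_valP a) => g; rewrite stabdegE. Qed.

Lemma xV_stab_comp w a y :
  xVcomp (xV_stab gr hx w a) y = xVcomp w y * hsub_val a.
Proof. by rewrite /xVcomp /= -(stab_entry a) hproj_VdegM. Qed.

(** Only the entry of [v] with source [y] contributes, because multiplying by an
    entry at (x,x) on the left keeps the source. *)
Lemma stab_Vx_comp a v y :
  Vxcomp (stab_Vx gr hx a v) y = hsub_val a * Vxcomp v y.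
Proof.
rewrite /Vxcomp /= {1}(Vx_row v) mulr_sumr hproj_sum (bigD1 y) //= big1 => [|t ty].
  by rewrite addr0 hproj_VdegM stab_entry.
by rewrite -(stab_entry a) -entry_mul entry_source_neq.
Qed.

Lemma pairing_comp v w :
  hsub_val (pairing gr hx v w) = \sum_y Vxcomp v y * xVcomp w y.
Proof.
have E a : hproj gr (stabdeg al e x) a = ent x x a.
  by apply: eq_bigl => g; rewrite stabdegE.
rewrite /= E {1}(xV_col w) mulr_sumr hproj_sum.
by apply: eq_bigr => y _; apply: hproj_VdegM.
Qed.

(** * The Morita context *)

Lemma stab_inj (a b : stab) : hsub_val a = hsub_val b -> a = b.
Proof. exact: val_inj. Qed.

Lemma stabM (a b : stab) : hsub_val (a * b) = hsub_val a * hsub_val b.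
Proof. by []. Qed.

Lemma stabL c (a b : stab) : hsub_val (c *: a + b) = c *: hsub_val a + hsub_val b.
Proof. by []. Qed.

Lemma stab1 : hsub_val (1 : stab) = \sum_(f | x \in X_ f) one_at gr f.
Proof.
rewrite (big_pred1 e) // => f.
by apply/idP/eqP => [/x_split|->].
Qed.

Lemma bimodule_Vx : bimodule (stab_Vx gr hx) (Vx_smash gr al x).
Proof.
split=> [v c a a'|a c v v'|v c u u'|u c v v'|v|a b v|v|v u u'|a v u];
  apply: VxcompP => y;
  rewrite ?(VxcompL, Vx_smash_comp, stab_Vx_comp).
- by rewrite stabL mul_linearl.
- by rewrite mul_linearr.
- by rewrite -sum_linear; apply: eq_bigr => z _; rewrite smash_entryL mul_linearr.
- by rewrite -sum_linear; apply: eq_bigr => z _; rewrite VxcompL mul_linearl.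
- by rewrite stab1 one_mul_entry.
- by rewrite stabM mulrA.
- rewrite (bigD1 y) //= smash_entry1 eqxx entry_mul_one big1 ?addr0 // => z /negPf ne.
  by rewrite smash_entry1 ne mulr0.
- under eq_bigr do rewrite smash_entryM.
  by rewrite sum_mul_sumA; apply: eq_bigr => z _; rewrite Vx_smash_comp.
by rewrite mulr_sumr; apply: eq_bigr => z _; rewrite stab_Vx_comp mulrA.
Qed.

Lemma bimodule_xV : bimodule (smash_xV gr al x) (xV_stab gr hx).
Proof.
split=> [w c u u'|u c w w'|w c a a'|a c w w'|w|u u' w|w|w a b|u w a];
  apply: xVcompP => z;
  rewrite ?(xVcompL, smash_xV_comp, xV_stab_comp).
- by rewrite -sum_linear; apply: eq_bigr => y _; rewrite smash_entryL mul_linearl.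
- by rewrite -sum_linear; apply: eq_bigr => y _; rewrite xVcompL mul_linearr.
- by rewrite stabL mul_linearr.
- by rewrite mul_linearl.
- rewrite (bigD1 z) //= smash_entry1 eqxx one_mul_entry big1 ?addr0 // => y /negPf ne.
  by rewrite smash_entry1 eq_sym ne mul0r.
- under eq_bigr do rewrite smash_entryM.
  by rewrite -sum_mul_sumA; apply: eq_bigr => y _; rewrite smash_xV_comp.
- by rewrite stab1 entry_mul_one.
- by rewrite stabM mulrA.
by rewrite mulr_suml; apply: eq_bigr => y _; rewrite xV_stab_comp mulrA.
Qed.

Lemma pairing_bimodule_morphism :
  tensor_bimodule_morphism (R := smash gr al) (S := stab)
    (stab_Vx gr hx) (Vx_smash gr al x) (smash_xV gr al x) (xV_stab gr hx)
    (pairing gr hx).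
Proof.
split=> [w c v v'|v c w w'|v u w|a v w|v w a]; apply: stab_inj;
  rewrite ?(stabL, stabM) !pairing_comp.
- by rewrite -sum_linear; apply: eq_bigr => y _; rewrite VxcompL mul_linearl.
- by rewrite -sum_linear; apply: eq_bigr => y _; rewrite xVcompL mul_linearr.
- under eq_bigr do rewrite Vx_smash_comp.
  by rewrite -sum_mul_sumA; apply: eq_bigr => y _; rewrite smash_xV_comp.
- by rewrite mulr_sumr; apply: eq_bigr => y _; rewrite stab_Vx_comp mulrA.
by rewrite mulr_suml; apply: eq_bigr => y _; rewrite xV_stab_comp mulrA.
Qed.

Lemma bracket_bimodule_morphism :
  tensor_bimodule_morphism (R := stab) (S := smash gr al)
    (smash_xV gr al x) (xV_stab gr hx) (stab_Vx gr hx) (Vx_smash gr al x)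
    (bracket gr al x).
Proof.
split=> [|w c v v'|w a v|u w v|w v u]; first exact: bracketL.
all: apply: smash_entryP => z y.
all: rewrite ?(smash_entryL, smash_entryM) !bracket_entry.
- by rewrite VxcompL mul_linearr.
- by rewrite xV_stab_comp stab_Vx_comp mulrA.
- rewrite smash_xV_comp mulr_suml; apply: eq_bigr => t _.
  by rewrite bracket_entry mulrA.
rewrite Vx_smash_comp mulr_sumr; apply: eq_bigr => t _.
by rewrite bracket_entry mulrA.
Qed.

Lemma smash_morita_context :
  morita_context (R := smash gr al) (V := Vx) (W := xV) (S := stab)
    (stab_Vx gr hx) (Vx_smash gr al x) (smash_xV gr al x) (xV_stab gr hx)
    (bracket gr al x) (pairing gr hx).
Proof.
split=> [||||v w v'|w v w'].
- exact: bimodule_Vx.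
- exact: bimodule_xV.
- exact: pairing_bimodule_morphism.
- exact: bracket_bimodule_morphism.
- apply: VxcompP => y; rewrite Vx_smash_comp stab_Vx_comp pairing_comp mulr_suml.
  by apply: eq_bigr => z _; rewrite bracket_entry mulrA.
apply: xVcompP => z; rewrite smash_xV_comp xV_stab_comp pairing_comp mulr_sumr.
by apply: eq_bigr => y _; rewrite bracket_entry mulrA.
Qed.

End AtPoint.

(** * Strictness *)

Section Transfer.
Variable (x : X).

Local Notation xV := (xV gr al x).
Local Notation Vx := (Vx gr al x).
Local Notation transfer := (transfer_sum gr al x).

Lemma transfer_sum_ind y (T : A -> Prop) :
  T 0 -> (forall c a b, T a -> T b -> T (c *: a + b)) ->
  (forall g a b, y \in X_ (d g) -> act g y = x ->
     a \in gpart gr (ginv Gd g) -> b \in gpart gr g -> T (a * b)) ->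
  forall t, transfer y t -> T t.
Proof.
move=> T0 TL TM; apply: lspan_ind => // t [g [yg gy]].
by apply: lspan_ind => // _ [a [b [ag bg ->]]]; apply: TM gy ag bg.
Qed.

Lemma transfer_sumM y g a b : y \in X_ (d g) -> act g y = x ->
  a \in gpart gr (ginv Gd g) -> b \in gpart gr g -> transfer y (a * b).
Proof.
move=> yg gy ag bg; apply: lspan_mem; exists g => //.
by apply: lspan_mem; exists a, b.
Qed.

Lemma transfer_sum_source y t : transfer y t -> source_sum gr al y t.
Proof.
apply: transfer_sum_ind t; [exact: lspan0 | exact: lspanL |].
move=> g a b yg _ ag bg; apply: lspan_mem; exists g => //.
by rewrite -gVmul; apply: gpartM ag bg; rewrite gdomV.
Qed.

(** If g and h are composable with g h the identity at [f], then g is the inverse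
    of h; so the part of degree [f] only collects products from A_(h^-1) A_h,
    with h taking [y] to [x]. *)
Lemma gcomp_gid_transfer y f a v :
  transfer y (gcomp gr (a * ent y x v) (gid Gd f)).
Proof.
move: (ent y x v) (hproj_hsum gr (Vdeg al y x) v) => {v}; apply: hsum_ind.
- by rewrite mulr0 gcomp0; apply: lspan0.
- by move=> b c hb hc; rewrite mulrDr gcompD; apply: lspanD.
move=> h b /and3P[yh _ /eqP hy] bh; move: a; apply: (gpart_ind (gr := gr)).
- by rewrite mul0r gcomp0; apply: lspan0.
- by move=> a c ha hc; rewrite mulrDl gcompD; apply: lspanD.
move=> g a ag; case: (d g =P r h) => gh; last first.
  by rewrite (gpartM0 gh ag bh) gcomp0; apply: lspan0.
rewrite (gcomp_id _ (gpartM gh ag bh)); case: eqP => ghf; last exact: lspan0.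
apply: (transfer_sumM yh hy _ bh).
suff <- : g = ginv Gd h by [].
have dhf : d h = f by rewrite -(gdomM gh) -ghf gdom_id.
rewrite -[LHS](gmul1 Gd) gh -gmulV gmulA ?grngV // -ghf -dhf.
by rewrite -(grngV Gd h) g1mul.
Qed.

Lemma bracket_surjective_transfer y t :
  tensor_surjective (bracket gr al x) -> source_sum gr al y t -> transfer y t.
Proof.
move=> br; apply: lspan_ind t; [exact: lspan0 | exact: lspanL |].
move=> t [g yg tg].
have [s /(congr1 (fun u : smash_sort gr al => u y))] := br (sdelta gr al t y).
rewrite (sdeltaE tg) ?gdom_id // eqxx smash_sumE => ts.
have -> : t = gcomp gr t (gid Gd (d g)) by rewrite (gcomp_id _ tg) eqxx.
rewrite ts; elim/big_ind: _ => [|a b ha hb|p _].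
- by rewrite gcomp0; apply: lspan0.
- by rewrite gcompD; apply: lspanD.
by rewrite bracket_col; apply: gcomp_gid_transfer.
Qed.

Lemma transfer_one y f : y \in X_ f ->
  (forall a, source_sum gr al y a -> transfer y a) -> transfer y (one_at gr f).
Proof.
move=> yf; apply; apply: lspan_mem; exists (gid Gd f); rewrite gdom_id //.
exact: one_at_gpart.
Qed.

Lemma transfer_degree g y : y \in X_ (d g) -> act g y = x -> Vdeg al y x g.
Proof. by move=> yg gy; rewrite /Vdeg yg -gy gact_to /=. Qed.

Lemma hom_in_xV g y a : Vdeg al x y g -> a \in gpart gr g ->
  a \in hsum gr (fun h => [exists y, Vdeg al x y h]).
Proof. by move=> xy ag; apply: (gpart_hsum _ ag); apply/existsP; exists y. Qed.

Lemma hom_in_Vx g y a : Vdeg al y x g -> a \in gpart gr g ->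
  a \in hsum gr (fun h => [exists y, Vdeg al y x h]).
Proof. by move=> yx ag; apply: (gpart_hsum _ ag); apply/existsP; exists y. Qed.

(** A generator a b, with a in A_(g^-1), b in A_g and g taking [y] to [x], is the
    bracket of a and b: b has its only nonzero component at [y], as arrows act
    injectively. *)
Lemma bracket_image_transfer y t : transfer y t ->
  tensor_image (bracket gr al x) (sdelta gr al t y).
Proof.
move: t; apply: transfer_sum_ind => [|c a b ha hb|g a b yg gy ag bg].
- by rewrite sdelta0; apply: tensor_image0.
- by rewrite sdeltaL; apply: tensor_imageL => // v; apply: bracketL.
have yx := transfer_degree yg gy.
pose w : xV := HSub (hom_in_xV (Vdeg_ginv yx) ag).
pose v : Vx := HSub (hom_in_Vx yx bg).
suff -> : sdelta gr al (a * b) y = bracket gr al x w v by apply: tensor_image_pure.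
apply: smashP => z; rewrite bracket_col /Vxcomp (hproj_gpart _ bg) /=.
have abg : a * b \in gpart gr (gmul Gd (ginv Gd g) g).
  by apply: (gpartM _ ag bg); rewrite gdomV.
rewrite (sdeltaE abg) ?gdomM ?gdomV //.
case: (z =P y) => [->|zy]; first by rewrite yx.
case: ifP => [zx|_]; last by rewrite mulr0.
by case: zy; apply: Vdeg_source_uniq zx yx.
Qed.

(** The product of a in A_(g^-1) and b in A_g, with g fixing [x], has the degree of
    the identity at [e], which fixes [x]; the projection defining the pairing
    therefore leaves it unchanged. *)
Lemma pairing_image_transfer e (hx : x \in X_ e) t :
  (forall f, x \in X_ f -> f = e) -> transfer x t ->
  exists2 u, tensor_image (pairing gr hx) u & hsub_val u = t.
Proof.
move=> x_split; move: t; apply: transfer_sum_ind.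
- by exists 0; first exact: tensor_image0.
- move=> c _ _ [u fu <-] [u' fu' <-]; exists (c *: u + u') => //.
  apply: tensor_imageL fu fu' => w.
  exact: (tbm_linl (pairing_bimodule_morphism hx x_split)).
move=> g a b xg gx ag bg.
have xx := transfer_degree xg gx.
pose v : Vx := HSub (hom_in_Vx (Vdeg_ginv xx) ag).
pose w : xV := HSub (hom_in_xV xx bg).
exists (pairing gr hx v w); first exact: tensor_image_pure.
have abg : a * b \in gpart gr (gmul Gd (ginv Gd g) g).
  by apply: (gpartM _ ag bg); rewrite gdomV.
rewrite /= (hproj_gpart _ abg) gVmul.
by rewrite /stabdeg gdom_id grng_id (x_split _ xg) gact1 // !eqxx.
Qed.

(** Both images are left ideals, so it is enough to reach the identities: that of
    the stabilizer algebra is 1_e, that of the smash product is the sum of the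
    1_f placed at the points over [f]. *)
Lemma transfer_one_strict e (hx : x \in X_ e) :
  (forall f, x \in X_ f -> f = e) ->
  (forall f y, y \in X_ f -> transfer y (one_at gr f)) ->
  strict (R := smash gr al) (V := Vx) (W := xV) (S := stab gr hx)
    (bracket gr al x) (pairing gr hx).
Proof.
move=> x_split one; split.
  apply: tensor_surjective_one (pairing_bimodule_morphism hx x_split) _.
  have [u fu u1] := pairing_image_transfer hx x_split (one e x hx).
  by rewrite (_ : 1 = u) //; apply: stab_inj; rewrite u1.
apply: tensor_surjective_one (bracket_bimodule_morphism hx x_split) _.
have brL := @bracketL x.
apply: tensor_image_sum => // f _; apply: tensor_image_sum => // y yf.
exact: bracket_image_transfer (one f y yf).
Qed.

End Transfer.
End Entries.

Theorem theorem5p3 (k : fieldType) (G0 : finType) (G : choiceType)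
    (Gd : groupoid G0 G) (A : kalgebra k) (gr : grading Gd A)
    (X : finType) (al : gset Gd X) (Xsplit : gset_split al)
    (e : G0) (x : X) (hx : x \in gact_on al e) :
  [/\ morita_context (R := smash gr al) (V := Vx gr al x)
        (W := xV gr al x) (S := stab gr hx)
        (stab_Vx gr hx) (Vx_smash gr al x) (smash_xV gr al x) (xV_stab gr hx)
        (bracket gr al x) (pairing gr hx),
      strict (R := smash gr al) (V := Vx gr al x)
        (W := xV gr al x) (S := stab gr hx)
        (bracket gr al x) (pairing gr hx) ->
      (forall f : G0, exists y : X, y \in gact_on al f) ->
      forall y : X, forall a : A,
        transfer_sum gr al x y a <-> source_sum gr al y a &
      (forall y : X, forall a : A,
        transfer_sum gr al x y a <-> source_sum gr al y a) ->
      strict (R := smash gr al) (V := Vx gr al x)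
        (W := xV gr al x) (S := stab gr hx)
        (bracket gr al x) (pairing gr hx)].
Proof.
have x_split f : x \in gact_on al f -> f = e.
  by move=> xf; apply: (proj2 Xsplit) xf hx.
split=> [|[_ br] _ y a|ts]; first exact: smash_morita_context.
- by split; [apply: transfer_sum_source | apply: bracket_surjective_transfer].
apply: transfer_one_strict => // f y yf; apply: transfer_one yf _ => a.
by case: (ts y a).
Qed.
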